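(* Let $H$ be a real Hilbert space, let $m\ge1$, let $\mathcal{A}_i:H\to2^H$ ($i=1,\dots,m$) be maximally monotone, let $\mathcal{B}:H\to H$ be monotone and $L$-Lipschitz ($L>0$), let $\mathcal{C}:H\to H$ be $\beta$-cocoercive ($\beta>0$), and assume that the set of $\mathbf{x}\in H$ with $0\in\sum_{i=1}^m\mathcal{A}_i\mathbf{x}+\mathcal{B}\mathbf{x}+\mathcal{C}\mathbf{x}$ is nonempty. Let $\omega_1,\dots,\omega_m\in(0,1]$ with $\sum_i\omega_i=1$, and let $\gamma\in\left(0,\frac{\beta}{2(1+4\beta L)}\right)$. Let $(\mathbf{z}_{i,0})_{i},(\mathbf{y}_{i,0})_i,(\mathbf{y}_{i,-1})_i\in H^m$ and iterate, for $n\ge0$, $$\mathbf{x}_{n+1}=\sum_{j=1}^m\omega_j\mathbf{z}_{j,n},$$ and for $i=1,\dots,m$: $$\mathbf{y}_{i,n+1}=J_{\frac{\gamma}{\omega_i}\mathcal{A}_i}\big(2\mathbf{x}_{n+1}-\mathbf{z}_{i,n}-2\gamma\mathcal{B}\mathbf{y}_{i,n}+\gamma\mathcal{B}\mathbf{y}_{i,n-1}-\gamma\mathcal{C}\mathbf{y}_{i,n}\big),\qquad \mathbf{z}_{i,n+1}=\mathbf{z}_{i,n}+\mathbf{y}_{i,n+1}-\mathbf{x}_{n+1}.$$ Then $\{\mathbf{x}_n\}$ converges weakly to a point $\mathbf{x}$ satisfying $0\in\sum_{i=1}^m\mathcal{A}_i\mathbf{x}+\mathcal{B}\mathbf{x}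+\mathcal{C}\mathbf{x}$.
   Context: $J_{T}=(\mathrm{Id}+T)^{-1}$ is the resolvent of a maximally monotone operator $T$. $\beta$-cocoercive means $\langle x-y,\mathcal{C}x-\mathcal{C}y\rangle\ge\beta\|\mathcal{C}x-\mathcal{C}y\|^2$ for all $x,y$. *)

(* Defs.v *)
(* A real Hilbert space is modelled as a complete
   normed module H over a realType R together with an inner product whose
   induced norm is the norm of H. *)
From HB Require Import structures.
From mathcomp Require Import all_boot all_order all_algebra.
From mathcomp Require Import all_classical all_reals all_analysis.
Set Implicit Arguments. Unset Strict Implicit. Unset Printing Implicit Defensive.
Import Order.TTheory GRing.Theory Num.Theory.
Import numFieldNormedType.Exports.
Local Open Scope classical_set_scope.
Local Open Scope ring_scope.

Section Defs.
Context {R : realType} {H : normedModType R}.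

Definition is_inner_product (inner : H -> H -> R) : Prop :=
  [/\ (forall x y, inner x y = inner y x),
      (forall a x y z, inner (a *: x + y) z = a * inner x z + inner y z)
    & (forall x, inner x x = `|x| ^+ 2)].

(* set-valued operators A : H -> 2^H; u \in A x is written A x u *)
Definition monotone_op (inner : H -> H -> R) (A : H -> set H) : Prop :=
  forall x y u v, A x u -> A y v -> 0 <= inner (x - y) (u - v).

Definition maximally_monotone (inner : H -> H -> R) (A : H -> set H) : Prop :=
  monotone_op inner A /\
  forall A' : H -> set H, monotone_op inner A' ->
    (forall x u, A x u -> A' x u) -> forall x u, A' x u -> A x u.

Definition monotone_fun (inner : H -> H -> R) (B : H -> H) : Prop :=
  forall x y, 0 <= inner (x - y) (B x - B y).

Definition lipschitz_with (L : R) (B : H -> H) : Prop :=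
  forall x y, `|B x - B y| <= L * `|x - y|.

Definition cocoercive (inner : H -> H -> R) (beta : R) (C : H -> H) : Prop :=
  forall x y, beta * `|C x - C y| ^+ 2 <= inner (x - y) (C x - C y).

(* resolvent J_{lam A} = (Id + lam A)^{-1}: J z is the y with z \in y + lam A y
   (well-defined and unique for A maximally monotone and lam > 0). *)
Definition resolvent (lam : R) (A : H -> set H) (z : H) : H :=
  xget z [set y | exists2 u, A y u & z = y + lam *: u].

Definition weakly_converges_to (inner : H -> H -> R) (u : nat -> H) (x : H)
  : Prop := forall v : H, (fun n => inner (u n) v) @ \oo --> inner x v.

End Defs.

(* Main.v *)
(** Work in [H^m] with the inner product weighted by [omega], where the
    orthogonal projection on the diagonal is the weighted mean.  With
    [d_n = z_{n+1} - z_n = y_{n+1} - x_{n+1}], [e_n = y_{n+1} - y_n] and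
    [q = gamma / beta + 4 gamma L], the function
<<
      |z_{n+1} - z*|^2 - 2 gamma <y_{n+1} - x*, B y_{n+1} - B y_n>
        + gamma L |e_n|^2 + q |d_n|^2
>>
    dominates [|z_{n+1} - z*|^2 / 2] and decreases by at least
    [(1 - 2 q) |d_{n+1}|^2] at each step; the bound on [gamma] says exactly
    [q < 1/2].  Hence [d_n -> 0], [z_n] is bounded and [|z_n - z*|] converges
    for each fixed point [z*].

    Limits are taken along ultrafilters [G] on [nat]: the Riesz representation
    theorem provides a weak limit of [z_n] along each [G].  Passing to the limit
    in the monotonicity inequalities, tested at a point obtained from a
    contraction (a resolvent of [gamma / omega_i A_i + gamma (B + C)]), shows
    that it is a fixed point, and Opial's argument shows that it does not depend
    on [G].

    The Riesz theorem and Minty's theorem (the resolvent is defined everywhere)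
    both come from the minimisation of a strongly convex function; for Minty's
    theorem this is the Fitzpatrick function plus half the squared norm. *)
Require Import Defs.
From HB Require Import structures.
From mathcomp Require Import all_boot all_order all_algebra.
From mathcomp Require Import all_classical all_reals all_analysis.
From mathcomp Require Import ring lra.
Import Order.TTheory GRing.Theory Num.Theory.
Import numFieldNormedType.Exports.
Local Open Scope classical_set_scope.
Local Open Scope ring_scope.

(** * Positive symmetric bilinear forms and the one-step estimate in abstract form *)

Section SymmetricForm.
Context {R : realType} {V : lmodType R}.
Variable f : V -> V -> R.

Definition symmetric_bilinear : Prop :=
  (forall x y, f x y = f y x) /\
  (forall a x y z, f (a *: x + y) z = a * f x z + f y z).

Hypothesis hf : symmetric_bilinear.

Lemma bformC x y : f x y = f y x. Proof. exact: hf.1. Qed.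

Lemma bformDl x y z : f (x + y) z = f x z + f y z.
Proof. by rewrite -[x]scale1r hf.2 mul1r scale1r. Qed.

Lemma bform0l z : f 0 z = 0.
Proof. by apply: (addrI (f 0 z)); rewrite -bformDl !addr0. Qed.

Lemma bformZl a x z : f (a *: x) z = a * f x z.
Proof. by rewrite -[a *: x]addr0 hf.2 bform0l addr0. Qed.

Lemma bformNl x z : f (- x) z = - f x z.
Proof. by rewrite -scaleN1r bformZl mulN1r. Qed.

Lemma bformDr x y z : f z (x + y) = f z x + f z y.
Proof. by rewrite bformC bformDl !(bformC z). Qed.

Lemma bform0r z : f z 0 = 0.
Proof. by rewrite bformC bform0l. Qed.

Lemma bformZr a x z : f z (a *: x) = a * f z x.
Proof. by rewrite bformC bformZl (bformC z). Qed.

Lemma bformNr x z : f z (- x) = - f z x.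
Proof. by rewrite bformC bformNl (bformC z). Qed.

Definition bformE := (bformDl, bformDr, bformNl, bformNr, bformZl, bformZr).

Lemma bform_suml (I : Type) (r : seq I) (P : pred I) (F : I -> V) z :
  f (\sum_(i <- r | P i) F i) z = \sum_(i <- r | P i) f (F i) z.
Proof.
by elim/big_rec2: _ => [|i y x _ <-]; rewrite ?bform0l ?bformDl.
Qed.

Hypothesis f_ge0 : forall x, 0 <= f x x.

(** Expand the square of [t *: x + y] and divide by [t]; replacing [x] by [- x] gives the other
    sign. *)
Lemma bform_young (t : R) x y :
  0 < t -> `|2 * f x y| <= t * f x x + t^-1 * f y y.
Proof.
move=> t0.
have key v : - (2 * f v y) <= t * f v v + t^-1 * f y y.
  have := f_ge0 (t *: v + y); rewrite !bformE (bformC y v) => h.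
  rewrite -(ler_pM2l t0) mulrDr mulrA [t * (t^-1 * _)]mulrA divff ?gt_eqF// mul1r.
  by nra.
rewrite ler_norml lerNl key /=.
by have := key (- x); rewrite !bformE mulrN !opprK.
Qed.

Lemma bform_sqD x y : f (x + y) (x + y) <= 2 * f x x + 2 * f y y.
Proof. have := f_ge0 (x - y); rewrite !bformE (bformC y x); lra. Qed.

(* p is the orthogonal projection of d on some subspace. *)
Lemma bform_sub_proj d p : f p d = f p p -> f (d - p) (d - p) <= f d d.
Proof. by move=> e; have := f_ge0 p; rewrite !bformE (bformC d p) e; lra. Qed.

(** Everything is measured from a fixed point: [a], [b], [c] stand for x, y, z, [b0] for the
    previous y, and the other vectors for values of B and C at three and one successive iterates.
    The four assumptions on [f] are, in order, orthogonality of the projection on the diagonal,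
    monotonicity of the A-part, monotonicity of B, and cocoercivity of C. *)
Lemma descent_step (beta gamma : R) (a b c b0 Bp B0 Bm C0 : V) :
  0 < beta -> 0 < gamma ->
  f a (c - a) = 0 ->
  0 <= f b (2 *: a - c - b - (2 * gamma) *: B0 + gamma *: Bm - gamma *: C0) ->
  0 <= f b Bp ->
  beta * f C0 C0 <= f b0 C0 ->
  f (c + b - a) (c + b - a) - 2 * gamma * f b (Bp - B0) <=
  f c c - 2 * gamma * f b0 (B0 - Bm) - f (b - a) (b - a)
  - 2 * gamma * f (b - b0) (B0 - Bm) + gamma / (2 * beta) * f (b - b0) (b - b0).
Proof.
move=> be0 ga0 hA hD hB hC.
(* The Young weight [2 * beta] makes the square of [C0] exactly what cocoercivity absorbs. *)
have hY : - (2 * gamma * f (b - b0) C0) <=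
    2 * gamma * beta * f C0 C0 + gamma / (2 * beta) * f (b - b0) (b - b0).
  have b2 : 0 < 2 * beta by lra.
  have := bform_young _ C0 (b - b0) b2; rewrite ler_norml => /andP[h _].
  have := ler_wpM2l (ltW ga0) h; rewrite [f C0 (b - b0)]bformC.
  by move: (2 * beta)^-1 => k; lra.
have hC' : 2 * gamma * beta * f C0 C0 <= 2 * gamma * f b0 C0.
  by rewrite -[_ * beta * _]mulrA ler_pM2l //; lra.
have hB' : 0 <= gamma * f b Bp by rewrite mulr_ge0 // ltW.
move: hY; set K := gamma / _ * _; move: K => K.
move: hA hD hC' hB'; rewrite !bformE.
rewrite (bformC b a) (bformC c a) (bformC c b).
lra.
Qed.

End SymmetricForm.

(** First-order optimality with slope [D]. If [D < 0], the choice [t = - D / (N - D)] lies in (0, 1]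
    and makes [D + t * N = t * D] negative. *)
Lemma ge0_of_quadratic_ge0 (R : realFieldType) (D N : R) : 0 <= N ->
  (forall t, 0 < t <= 1 -> 0 <= t * D + t ^+ 2 * N) -> 0 <= D.
Proof.
move=> N0 h; rewrite leNgt; apply/negP => D0.
have k0 : 0 < N - D by lra.
have t0 : 0 < - D / (N - D) by rewrite divr_gt0 //; lra.
have t1 : - D / (N - D) <= 1 by rewrite ler_pdivrMr //; lra.
have := h _ (introT andP (conj t0 t1)).
have e : - D / (N - D) * (N - D) = - D by rewrite mulfVK // gt_eqF.
move: t0 t1 e; move: (- D / (N - D)) => t t0 t1 e.
have e2 : t * D = D + t * N by lra.
have -> : t * D + t ^+ 2 * N = t * (t * D) by rewrite [in RHS]e2; ring.
by rewrite pmulr_rge0 // pmulr_rge0 //; lra.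
Qed.

Lemma cvg_of_sqr_dist (R : realType) (H : completeNormedModType R)
    (u : nat -> H) (d : nat -> R) : d @ \oo --> (0 : R) ->
  (forall n k, `|u n - u k| ^+ 2 <= d n + d k) -> cvgn u.
Proof.
move=> d0 ud; apply/cauchy_cvgP; apply/cauchy_ballP => e e0; near_simpl.
have he : 0 < e ^+ 2 / 2 by rewrite divr_gt0 // exprn_gt0.
have dlt : \forall n \near \oo, d n < e ^+ 2 / 2.
  by move/cvgrPdist_lt/(_ _ he): d0; apply: filterS => n /=;
     rewrite sub0r normrN; apply: le_lt_trans (ler_norm _).
near=> n k; rewrite -ball_normE /=.
rewrite -(ltr_pXn2r (n := 2)) ?nnegrE ?normr_ge0 ?(ltW e0) //.
apply: le_lt_trans (ud n k) _.
rewrite [ltRHS](splitr (e ^+ 2)); apply: ltrD.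
  by near: n.
by near: k.
Unshelve. all: by end_near. Qed.

(** * Minimisation of strongly convex functions and the Riesz theorem *)

Section Hilbert.
Context {R : realType} {H : completeNormedModType R}.
Variable inner : H -> H -> R.
Hypothesis hi : is_inner_product inner.

Lemma inner_symmetric_bilinear : symmetric_bilinear inner.
Proof. by case: hi => hC hL _; split. Qed.

Local Notation sb := inner_symmetric_bilinear.

Lemma innerxx x : inner x x = `|x| ^+ 2. Proof. by case: hi. Qed.

Lemma inner_ge0 x : 0 <= inner x x.
Proof. by rewrite innerxx exprn_ge0. Qed.

Lemma inner_ext x y : (forall v, inner x v = inner y v) -> x = y.
Proof.
move=> h; apply/eqP; rewrite -subr_eq0 -normr_eq0 -sqrf_eq0 -innerxx.
by rewrite (bformDl _ sb) (bformNl _ sb) h subrr.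
Qed.

Lemma inner_cauchy_schwarz x y : `|inner x y| <= `|x| * `|y|.
Proof.
have [->|y0] := eqVneq y 0; first by rewrite (bform0r _ sb) !normr0 mulr0.
have yp : 0 < `|y| ^+ 2 by rewrite exprn_gt0 // normr_gt0.
rewrite -(ler_pXn2r (n := 2)) ?nnegrE ?mulr_ge0 // exprMn real_normK ?num_real //.
have := inner_ge0 (`|y| ^+ 2 *: x - inner x y *: y).
rewrite !(bformE _ sb) !innerxx (bformC _ sb y x) => h.
rewrite -(ler_pM2l yp); move: h; move: (`|y| ^+ 2) (`|x| ^+ 2) (inner x y).
by move=> a b c; lra.
Qed.

Lemma inner_cvg0 {T : Type} {F : set_system T} {FF : Filter F} (u v : T -> H)
    (M : R) : (forall n, `|u n| <= M) -> v @ F --> (0 : H) ->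
  inner (u n) (v n) @[n --> F] --> (0 : R).
Proof.
move=> uM v0; apply/norm_cvg0P.
have M0 : 0 <= `|M| + 1 by rewrite addr_ge0.
apply: (@squeeze_cvgr _ _ _ _ (fun=> 0) (fun n => (`|M| + 1) * `|v n|)).
- apply: nearW => n; rewrite normr_ge0 /=.
  apply: le_trans (inner_cauchy_schwarz _ _) _; apply: ler_wpM2r => //.
  by apply: le_trans (uM n) _; have := ler_norm M; lra.
- exact: cvg_cst.
- rewrite -[X in _ --> X](mulr0 (`|M| + 1)); apply: cvgMl_tmp; exact/norm_cvg0P.
Qed.

Lemma inner_cvgl {T : Type} {F : set_system T} {FF : Filter F} (u : T -> H) p v :
  u @ F --> p -> inner (u n) v @[n --> F] --> inner p v.
Proof.
move=> up.
have e : (fun n => inner (u n) v) = (fun n => inner v (u n - p) + inner p v).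
  by apply/funext => n; rewrite !(bformE _ sb) (bformC _ sb v p) (bformC _ sb v); lra.
rewrite e -[X in _ --> X]add0r; apply: cvgD; last exact: cvg_cst.
apply: (@inner_cvg0 _ _ _ (fun=> v) _ `|v|) => //.
by apply/subr_cvg0.
Qed.

(** [K] plays the role of the epigraph of a closed convex function of two variables; a relation
    leaves room for infinite values. A minimising sequence of that function plus half the squared
    norm is Cauchy, and the final inequality is the first-order condition at its limit. *)
Lemma strongly_convex_min (K : H -> H -> R -> Prop) (b : R) :
  (exists x u r, K x u r) ->
  (forall x u r y v s t, K x u r -> K y v s -> 0 <= t <= 1 ->
    K (x + t *: (y - x)) (u + t *: (v - u)) (r + t * (s - r))) ->
  (forall (X U : nat -> H) (S : nat -> R) x u r, X @ \oo --> x ->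
    U @ \oo --> u -> S @ \oo --> r -> (forall n, K (X n) (U n) (S n)) ->
    K x u r) ->
  (forall x u r, K x u r -> b <= r + (inner x x + inner u u) / 2) ->
  exists x u r, K x u r /\
    forall y v s, K y v s ->
      r + inner x x + inner u u <= s + inner x y + inner u v.
Proof.
move=> [x0 [u0 [r0 K0]]] Kconv Kclosed Kb.
pose G (x u : H) (r : R) := r + (inner x x + inner u u) / 2.
have [i [Sle Sadh]] : exists i : R, (forall x u r, K x u r -> i <= G x u r) /\
    (forall e : R, 0 < e ->
      exists p : H * H * R, K p.1.1 p.1.2 p.2 /\ G p.1.1 p.1.2 p.2 < i + e).
  pose S := [set g | exists x u r, K x u r /\ g = G x u r].
  have Sinf : has_inf S.
    split; first by exists (G x0 u0 r0), x0, u0, r0.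
    by exists b => _ [x [u [r [Kxur ->]]]]; exact: Kb.
  exists (inf S); split=> [x u r Kx|e e0].
    by apply: ge_inf; [exact: Sinf.2|exists x, u, r].
  by have [_ [x [u [r [Kx ->]]]] h] := inf_adherent e0 Sinf; exists (x, u, r).
have /choice[P HP] : forall n : nat, exists p : H * H * R,
    K p.1.1 p.1.2 p.2 /\ G p.1.1 p.1.2 p.2 < i + n.+1%:R^-1.
  by move=> n; apply: Sadh; rewrite invr_gt0 ltr0n.
pose X n := (P n).1.1; pose U n := (P n).1.2; pose T n := (P n).2.
(* At a midpoint the objective is the average of the two values minus an eighth of the squared
   distance, whence the factor 4. *)
pose d (n : nat) : R := 4 * n.+1%:R^-1.
have dn0 : d @ \oo --> (0 : R).
  by rewrite -(mulr0 4); apply: cvgMl_tmp; exact: cvg_harmonic.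
have par n k : `|X n - X k| ^+ 2 + `|U n - U k| ^+ 2 <= d n + d k.
  have [[Kn hn] [Kk hk]] := (HP n, HP k).
  have ht : 0 <= (2^-1 : R) <= 1 by apply/andP; split; lra.
  have := Sle _ _ _ (Kconv _ _ _ _ _ _ _ Kn Kk ht).
  move: hn hk; rewrite -!innerxx -/(X n) -/(X k) -/(U n) -/(U k) -/(T n) -/(T k).
  rewrite /G !(bformE _ sb) (bformC _ sb (X k) (X n)) (bformC _ sb (U k) (U n)) /d.
  by move: n.+1%:R^-1 k.+1%:R^-1 => p q; lra.
have Xc : cvgn X.
  apply: cvg_of_sqr_dist dn0 _ => n k.
  by apply: le_trans (par n k); rewrite lerDl exprn_ge0.
have Uc : cvgn U.
  apply: cvg_of_sqr_dist dn0 _ => n k.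
  by apply: le_trans (par n k); rewrite lerDr exprn_ge0.
set x := limn X in Xc; set u := limn U in Uc.
have sq (W : nat -> H) w : W @ \oo --> w ->
    inner (W n) (W n) @[n --> \oo] --> inner w w.
  move=> Ww; rewrite innerxx; under eq_fun do rewrite innerxx.
  by rewrite expr2; under eq_fun do rewrite expr2; apply: cvgM; exact: cvg_norm.
have GT : (fun n => G (X n) (U n) (T n)) @ \oo --> i.
  apply: (@squeeze_cvgr _ _ _ _ (fun=> i) (fun n => i + n.+1%:R^-1)).
  - by apply: nearW => n; have [Kn hn] := HP n; rewrite Sle //= ltW.
  - exact: cvg_cst.
  - rewrite -[X in _ --> X]addr0; apply: cvgD; first exact: cvg_cst.
    exact: cvg_harmonic.
pose r := i - (inner x x + inner u u) / 2.
have Tr : T @ \oo --> r.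
  have -> : T = (fun n => G (X n) (U n) (T n) -
      (inner (X n) (X n) + inner (U n) (U n)) / 2).
    by apply/funext => n; rewrite /G; lra.
  apply: cvgB => //; apply: cvgMr_tmp; apply: cvgD; exact: sq.
have Kx : K x u r.
  by apply: (Kclosed X U T) => // n; exact: (HP n).1.
exists x, u, r; split=> // y v s Ky.
(* [D] and [N] are the linear and quadratic coefficients of the objective along the segment towards
   [(y, v, s)]. *)
pose D := s - r + inner x (y - x) + inner u (v - u).
pose N := (inner (y - x) (y - x) + inner (v - u) (v - u)) / 2.
suff : 0 <= D by rewrite /D !(bformE _ sb); lra.
apply: (@ge0_of_quadratic_ge0 _ _ N).
  by rewrite /N divr_ge0 // addr_ge0 // inner_ge0.
move=> t /andP[t0 t1].
have ht : 0 <= t <= 1 by rewrite ltW.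
have := Sle _ _ _ (Kconv _ _ _ _ _ _ _ Kx Ky ht).
rewrite /G /D /N /r; move: (y - x) (v - u) => p q.
rewrite !(bformE _ sb) (bformC _ sb p x) (bformC _ sb q u).
lra.
Qed.

(** Minimise half the squared norm minus [g], with the second variable pinned at 0; the lower bound
    comes from [(M - |x|)^2 >= 0]. Optimality gives [g w <= inner x w], and the change of [w] into
    [- w] gives equality. *)
Lemma riesz_representation (g : H -> R) (M : R) :
  (forall a x y, g (a *: x + y) = a * g x + g y) ->
  (forall x, `|g x| <= M * `|x|) -> exists p, forall v, g v = inner p v.
Proof.
move=> glin gM.
have gD x y : g (x + y) = g x + g y by rewrite -[x]scale1r glin mul1r scale1r.
have g0 : g 0 = 0 by apply: (addrI (g 0)); rewrite -gD !addr0.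
have gZ a x : g (a *: x) = a * g x by rewrite -[a *: x]addr0 glin g0 addr0.
have gN x : g (- x) = - g x by rewrite -scaleN1r gZ mulN1r.
have [||||x [u [r [[_ gr] hr]]]] :=
  @strongly_convex_min (fun x u r => u = 0 /\ - g x <= r) (- (M ^+ 2 / 2)).
- by exists 0, 0, 0; split => //; rewrite g0 oppr0.
- move=> x u r y v s t [-> hx] [-> hy] /andP[t0 t1]; split.
    by rewrite subrr scaler0 addr0.
  rewrite gD gZ gD gN.
  have h1 : 0 <= (1 - t) * (r + g x) by rewrite mulr_ge0 //; lra.
  have h2 : 0 <= t * (s + g y) by rewrite mulr_ge0 //; lra.
  lra.
- move=> X U S x u r Xx Uu Sr hK; split.
    apply: (cvg_unique _ Uu); first exact: norm_hausdorff.
    have -> : U = fun=> 0 by apply/funext => n; case: (hK n).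
    exact: cvg_cst.
  have gX : g (X n) @[n --> \oo] --> g x.
    apply/subr_cvg0/norm_cvg0P.
    apply: (@squeeze_cvgr _ _ _ _ (fun=> 0) (fun n => M * `|X n - x|)).
    + by apply: nearW => n; rewrite normr_ge0 /= -gN -gD.
    + exact: cvg_cst.
    + rewrite -[X in _ --> X](mulr0 M); apply: cvgMl_tmp; apply/norm_cvg0P.
      exact/subr_cvg0.
  apply: (ler_cvg_to (cvgN gX) Sr); apply: nearW => n; exact: (hK n).2.
- move=> x u r [-> h]; rewrite (bform0l _ sb) innerxx addr0.
  have := le_trans (ler_norm _) (gM x); have := sqr_ge0 (M - `|x|).
  by rewrite sqrrB; move: (`|x|) => k; lra.
exists x => v.
have key w : g w <= inner x w.
  have := hr (x + w) 0 (- g (x + w)) (conj erefl (lexx _)).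
  by rewrite gD (bform0r _ sb) (bformDr _ sb); have := inner_ge0 u; lra.
by apply/eqP; rewrite eq_le key /=; have := key (- v); rewrite gN (bformNr _ sb); lra.
Qed.

End Hilbert.

(** If the preimage of a neighbourhood is not in [F], then [F] restricted to its complement is
    proper and extends to an ultrafilter along which convergence fails. *)
Lemma cvg_of_ultrafilters (T : Type) (F : set_system T) (FF : Filter F)
    (X : topologicalType) (s : T -> X) (l : X) :
  (forall G, UltraFilter G -> F `<=` G -> s @ G --> l) -> s @ F --> l.
Proof.
move=> h N Nl; apply: contrapT => nF.
have WP : ProperFilter (within (~` (s @^-1` N)) F).
  apply: Build_ProperFilter_ex => P WPP; apply: contrapT => nP; apply: nF.
  rewrite /within /= in WPP; apply: filterS WPP => t tP.
  by apply: contrapT => nt; apply: nP; exists t; exact: tP.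
have [G [GU sub]] := ultraFilterLemma WP.
have GF : F `<=` G by move=> P FP; apply: sub; apply: filterS FP => t Pt _.
have GN : G (s @^-1` N) := h G GU GF N Nl.
have GnN : G (~` (s @^-1` N)) by apply: sub; exact: withinT.
by have [t [? ?]] := filter_ex (filterI GN GnN).
Qed.

(** Compactness of the segment gives a cluster point, and an ultrafilter converges to each of its
    cluster points. *)
Lemma ultra_bounded_cvg (R : realType) (T : Type) (G : set_system T)
    (GU : UltraFilter G) (s : T -> R) (M : R) :
  (forall t, `|s t| <= M) -> exists l : R, s @ G --> l.
Proof.
move=> sM.
have : (s @ G) `[- M, M]%classic.
  by apply: nearW => t /=; rewrite in_itv /= -ler_norml.
move/(segment_compact (fmap_proper_filter _ _)) => [l [_ cl]].
exists l => N Nl.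
have [//|GN] := in_ultra_setVsetC (s @^-1` N) GU.
by have [t [? ?]] := cl (~` N) N GN Nl.
Qed.

(** * Maximally monotone operators, Minty's theorem, resolvents and weak limits *)

Section MaximallyMonotone.
Context {R : realType} {H : completeNormedModType R}.
Variable inner : H -> H -> R.
Hypothesis hi : is_inner_product inner.

Local Notation sb := (inner_symmetric_bilinear inner hi).

(** A graph enlarged by one monotonically related pair stays monotone, so maximality already
    contains that pair. *)
Lemma maximally_monotoneP (A : H -> set H) :
  maximally_monotone inner A <-> monotone_op inner A /\
  forall x u, (forall y v, A y v -> 0 <= inner (x - y) (u - v)) -> A x u.
Proof.
split=> [[mA maxA]|[mA maxA]]; split=> //.
  move=> x u xu; pose A' a b := A a b \/ (a = x /\ b = u).
  apply: (maxA A'); [|by left|by right].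
  move=> a b c d [Aac|[-> ->]] [Abd|[-> ->]].
  - exact: mA.
  - by rewrite -(opprB x) -(opprB u) (bformNl _ sb) (bformNr _ sb) opprK; exact: xu.
  - exact: xu.
  - by rewrite subrr (bform0l _ sb).
move=> A' mA' sub x u A'xu; apply: maxA => y v Ayv.
by apply: mA' => //; exact: sub.
Qed.

(* The Fitzpatrick function of [A] is the least [r] with [K x u r] below; its
   minimum after adding half the squared norm is attained at a point [(x, u)]
   for which [(- u, - x)] is monotonically related to the graph of [A]. *)
Lemma minty_zero (A : H -> set H) : maximally_monotone inner A ->
  exists y, A y (- y).
Proof.
move=> /maximally_monotoneP[mA maxA].
pose K (x u : H) (r : R) :=
  forall y v, A y v -> inner x v + inner y u - inner y v <= r.
(* Otherwise [(x, u)] is monotonically related to the graph, hence in it, and testing [K] at this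
   very pair gives a contradiction. *)
have Kge x u r : K x u r -> inner x u <= r.
  move=> Kx; rewrite leNgt; apply/negP => lt.
  suff Axu : A x u by have := Kx _ _ Axu; lra.
  by apply: maxA => y v Ayv; have := Kx _ _ Ayv; rewrite !(bformE _ sb); lra.
have AK y v : A y v -> K y v (inner y v).
  by move=> Ayv y' v' A'; have := mA _ _ _ _ Ayv A'; rewrite !(bformE _ sb); lra.
(* With an empty graph, every pair would be vacuously related to it. *)
have [y0 [v0 A0]] : exists y v, A y v.
  apply: contrapT => nA; apply: (nA); exists 0, 0; apply: maxA => y v Ayv.
  by case: nA; exists y, v.
have [||||x [u [r [Kx hr]]]] := @strongly_convex_min _ _ _ hi K 0.
- by exists y0, v0, (inner y0 v0); exact: AK.
- move=> x u r y v s t Kx Ky /andP[t0 t1] a b Aab.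
  have h1 : 0 <= (1 - t) * (r - (inner x b + inner a u - inner a b)).
    by rewrite mulr_ge0 // ?subr_ge0 //; exact: Kx.
  have h2 : 0 <= t * (s - (inner y b + inner a v - inner a b)).
    by rewrite mulr_ge0 // ?subr_ge0 //; exact: Ky.
  by rewrite !(bformE _ sb); lra.
- move=> X U S x u r Xx Uu Sr hK y v Ayv.
  have cX := inner_cvgl _ hi X x v Xx; have cU := inner_cvgl _ hi U u y Uu.
  rewrite (bformC _ sb y u).
  have cc : (fun n => inner (X n) v + inner (U n) y - inner y v) @ \oo -->
      inner x v + inner u y - inner y v.
    apply: cvgB; last exact: cvg_cst.
    by apply: cvgD; [exact: cX|exact: cU].
  apply: (ler_cvg_to cc Sr).
  by apply: nearW => n; have := hK n _ _ Ayv; rewrite (bformC _ sb y (U n)).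
- move=> x u r Kx; have := Kge _ _ _ Kx; have := inner_ge0 _ hi (x + u).
  by rewrite !(bformE _ sb) (bformC _ sb u x); lra.
have rel y v : A y v -> `|x + u| ^+ 2 <= inner (- u - y) (- x - v).
  move=> Ayv; have := hr _ _ _ (AK _ _ Ayv); have := Kge _ _ _ Kx.
  rewrite -(innerxx _ hi) !(bformE _ sb) (bformC _ sb y x) (bformC _ sb u x); lra.
have Aux : A (- u) (- x).
  by apply: maxA => y v Ayv; apply: le_trans (rel _ _ Ayv); rewrite exprn_ge0.
exists (- u); rewrite opprK.
(* Testing the bound at its own pair forces [x = - u]. *)
have := rel _ _ Aux; rewrite !subrr (bform0l _ sb) => h.
have xu : x + u == 0 by rewrite -normr_eq0 -sqrf_eq0 eq_le h exprn_ge0.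
by move: Aux xu; rewrite addr_eq0 => + /eqP e; rewrite e opprK.
Qed.

(** [minty_zero] for the operator [lam A - z], which is again maximally monotone. *)
Lemma minty (A : H -> set H) (lam : R) (z : H) :
  maximally_monotone inner A -> 0 < lam ->
  exists y u, A y u /\ z = y + lam *: u.
Proof.
move=> /maximally_monotoneP[mA maxA] l0.
have lV : 0 < lam^-1 by rewrite invr_gt0.
have ln : lam != 0 by rewrite gt_eqF.
have [|y Ay] := @minty_zero (fun y v => A y (lam^-1 *: (v + z))).
  apply/maximally_monotoneP; split=> [x y u v Ax Ay|x u h].
    have := mA _ _ _ _ Ax Ay; rewrite -scalerBr opprD addrACA subrr addr0.
    by rewrite (bformZr _ sb) pmulr_rge0.
  apply: maxA => y v Ayv.
  have := h y (lam *: v - z); rewrite subrK scalerA mulVf // scale1r => /(_ Ayv).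
  have -> : u - (lam *: v - z) = lam *: (lam^-1 *: (u + z) - v).
    by rewrite scalerBr scalerA divff // scale1r opprB addrA.
  by rewrite (bformZr _ sb) pmulr_rge0.
exists y, (lam^-1 *: (- y + z)); split=> //.
by rewrite scalerA divff // scale1r addrA subrr add0r.
Qed.

(** By Minty's theorem the set under [xget] is nonempty, so the default value is not taken. *)
Lemma resolventP (A : H -> set H) (lam : R) (z : H) :
  maximally_monotone inner A -> 0 < lam ->
  exists u, A (resolvent lam A z) u /\ z = resolvent lam A z + lam *: u.
Proof.
move=> mA l0; have [y [u [Ayu e]]] := minty _ _ z mA l0.
have : [set y | exists2 u, A y u & z = y + lam *: u] !=set0 by exists y, u.
by move/(xgetPex z) => [v Av ev]; exists v.
Qed.

Lemma resolvent_nonexpansive (A : H -> set H) (lam : R) (z w : H) :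
  maximally_monotone inner A -> 0 < lam ->
  `|resolvent lam A z - resolvent lam A w| <= `|z - w|.
Proof.
move=> mA l0; have [u [Au eu]] := resolventP _ _ z mA l0.
have [v [Av ev]] := resolventP _ _ w mA l0.
move: Au eu Av ev; move: (resolvent lam A z) (resolvent lam A w) => y y' Au eu Av ev.
have h := mA.1 _ _ _ _ Au Av.
have : `|y - y'| ^+ 2 <= inner (y - y') (z - w).
  have -> : z - w = (y - y') + lam *: (u - v).
    by rewrite eu ev opprD addrACA -scalerBr.
  by rewrite (bformDr inner sb (y - y')) (bformZr _ sb) (innerxx _ hi) lerDl mulr_ge0 // ltW.
have := le_trans (ler_norm _) (inner_cauchy_schwarz _ hi (y - y') (z - w)).
have [->|ne] := eqVneq (y - y') 0; first by rewrite normr0.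
move=> h1 h2; have := le_trans h2 h1; rewrite expr2 ler_pM2l //.
by rewrite normr_gt0.
Qed.

(** Banach's fixed point theorem for [q |-> resolvent lam A (w - F q)], a [k]-contraction since
    resolvents are nonexpansive. *)
Lemma resolvent_contraction (A : H -> set H) (F : H -> H) (lam k : R) (w : H) :
  maximally_monotone inner A -> 0 < lam -> 0 <= k < 1 -> lipschitz_with k F ->
  exists q u, A q u /\ w = q + lam *: u + F q.
Proof.
move=> mA l0 /andP[k0 k1] lF.
pose T q := resolvent lam A (w - F q).
have TT : {homo T : x / [set: H] x >-> [set: H] x} by [].
have [|||q _ eq] := @banach_fixed_point _ _ setT (mkfun_fun TT).
- exists (NngNum k0); split=> // -[a b] _ /=.
  apply: le_trans (resolvent_nonexpansive _ _ _ _ mA l0) _.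
  by rewrite opprB addrC addrA subrK distrC; exact: lF.
- exact: closedT.
- by exists 0.
have [u [Au eu]] := resolventP _ _ (w - F q) mA l0.
exists q, u; rewrite {1 2}eq; split=> //.
by rewrite /= -/(T q) in Au eu *; rewrite -eu subrK.
Qed.

Definition weak_cvg (T : Type) (F : set_system T) (u : T -> H) (p : H) : Prop :=
  forall v, inner (u t) v @[t --> F] --> inner p v.

(** The limits of [inner (u t) v] along [G] form a bounded linear functional of [v], which Riesz
    represents. *)
Lemma ultra_bounded_weak_cvg (T : Type) (G : set_system T) (GU : UltraFilter G)
    (u : T -> H) (M : R) : (forall t, `|u t| <= M) -> exists p, weak_cvg T G u p.
Proof.
move=> uM.
have ub v t : `|inner (u t) v| <= M * `|v|.
  apply: le_trans (inner_cauchy_schwarz _ hi _ _) _; exact: ler_wpM2r.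
have /choice[g hg] : forall v, exists l : R, inner (u t) v @[t --> G] --> l.
  by move=> v; exact: ultra_bounded_cvg (ub v).
have [||p hp] := riesz_representation _ hi g M.
- move=> a x y; apply: (cvg_unique _ (hg _)); first exact: norm_hausdorff.
  have -> : (fun t => inner (u t) (a *: x + y)) =
      (fun t => a * inner (u t) x + inner (u t) y).
    by apply/funext => t; rewrite !(bformE _ sb).
  by apply: cvgD; [apply: cvgMl_tmp|].
- move=> x; apply: (cvgr_to_le (cvg_norm (hg x))); exact: nearW.
by exists p => v; rewrite -hp.
Qed.

End MaximallyMonotone.

Lemma subrBB (V : zmodType) (s t p : V) : (s - p) - (t - p) = s - t.
Proof. by rewrite opprB addrA subrK. Qed.

(** * The weighted product space and the projection on its diagonal *)

Section WeightedProduct.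
Context {R : realType} {H : completeNormedModType R}.
Variable inner : H -> H -> R.
Hypothesis hi : is_inner_product inner.
Variables (m : nat) (omega : 'I_m -> R).
Hypothesis omega_gt0 : forall i, 0 < omega i.
Hypothesis omega1 : \sum_(i < m) omega i = 1.

Local Notation sb := (inner_symmetric_bilinear inner hi).

Definition winner (a b : 'I_m -> H) : R := \sum_(i < m) omega i * inner (a i) (b i).

Definition wmean (a : 'I_m -> H) : H := \sum_(i < m) omega i *: a i.

Definition diag (p : H) : 'I_m -> H := fun=> p.

Lemma winner_symmetric_bilinear : symmetric_bilinear winner.
Proof.
split=> [a b|k a b c].
  by apply: eq_bigr => i _; rewrite (bformC _ sb).
rewrite mulr_sumr -big_split; apply: eq_bigr => i _ /=.
rewrite -[(_ + b) i]/(k *: a i + b i) !(bformE _ sb); ring.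
Qed.

Local Notation wsb := winner_symmetric_bilinear.

Lemma winner_ge0 a : 0 <= winner a a.
Proof. by apply: sumr_ge0 => i _; rewrite mulr_ge0 ?inner_ge0 // ltW. Qed.

Lemma le_winner a i : omega i * `|a i| ^+ 2 <= winner a a.
Proof.
rewrite /winner (bigD1 i) //= innerxx // lerDl.
by apply: sumr_ge0 => j _; rewrite mulr_ge0 ?inner_ge0 // ltW.
Qed.

Lemma winner_eq0 a : winner a a <= 0 -> forall i, a i = 0.
Proof.
move=> a0 i; have := le_trans (le_winner a i) a0.
rewrite pmulr_rle0 // => h; apply/eqP; rewrite -normr_eq0 -sqrf_eq0 eq_le h.
by rewrite exprn_ge0.
Qed.

Lemma wmeanB a b : wmean (a - b) = wmean a - wmean b.
Proof.
rewrite /wmean -sumrB; apply: eq_bigr => i _; exact: scalerBr.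
Qed.

Lemma wmeanD a b : wmean (a + b) = wmean a + wmean b.
Proof.
rewrite /wmean -big_split; apply: eq_bigr => i _; exact: scalerDr.
Qed.

Lemma diagB p q : diag (p - q) = diag p - diag q. Proof. by []. Qed.

Lemma wmean_diag p : wmean (diag p) = p.
Proof. by rewrite /wmean -scaler_suml omega1 scale1r. Qed.

Lemma winner_diagl p a : winner (diag p) a = inner p (wmean a).
Proof.
rewrite (bformC _ sb) (bform_suml _ sb); apply: eq_bigr => i _.
by rewrite (bformZl _ sb) (bformC _ sb).
Qed.

Lemma winner_proj a : winner (diag (wmean a)) a =
  winner (diag (wmean a)) (diag (wmean a)).
Proof. by rewrite !winner_diagl wmean_diag. Qed.

Lemma winner_proj_le a : winner (diag (wmean a)) (diag (wmean a)) <= winner a a.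
Proof.
have := winner_ge0 (a - diag (wmean a)).
by rewrite !(bformE _ wsb) (bformC _ wsb a) winner_proj; lra.
Qed.

Lemma winner_cvg0 {T : Type} {F : set_system T} {FF : Filter F}
    (a : T -> 'I_m -> H) : winner (a t) (a t) @[t --> F] --> (0 : R) ->
  forall i, a t i @[t --> F] --> (0 : H).
Proof.
move=> a0 i; apply/cvgrPdist_lt => e e0.
have he : 0 < omega i * e ^+ 2 by rewrite mulr_gt0 ?exprn_gt0.
move/cvgrPdist_lt/(_ _ he): a0; apply: filterS => t.
rewrite !sub0r !normrN ger0_norm ?winner_ge0 // => /(le_lt_trans (le_winner _ i)).
by rewrite ltr_pM2l // ltr_pXn2r // ?nnegrE // ltW.
Qed.

Lemma wsum_cvg {T : Type} {F : set_system T} {FF : Filter F}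
    (a : T -> 'I_m -> R) (b : 'I_m -> R) : (forall i, a t i @[t --> F] --> b i) ->
  \sum_(i < m) omega i * a t i @[t --> F] --> \sum_(i < m) omega i * b i.
Proof.
move=> ab; apply: (cvg_big (op := +%R)); first exact: add_continuous.
by move=> i _; apply: cvgMl_tmp; exact: ab.
Qed.

Lemma winner_cvg {T : Type} {F : set_system T} {FF : Filter F}
    (a : T -> 'I_m -> H) (b c : 'I_m -> H) :
  (forall i, weak_cvg inner T F (a ^~ i) (b i)) ->
  winner (a t) c @[t --> F] --> winner b c.
Proof. by move=> ab; apply: wsum_cvg => i; exact: ab. Qed.

Lemma weak_cvg_wmean {T : Type} {F : set_system T} {FF : Filter F}
    (a : T -> 'I_m -> H) (b : 'I_m -> H) :
  (forall i, weak_cvg inner T F (a ^~ i) (b i)) ->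
  weak_cvg inner T F (wmean \o a) (wmean b).
Proof.
move=> ab v; rewrite (bformC _ sb) -winner_diagl (bformC _ wsb).
have -> : (fun t => inner ((wmean \o a) t) v) = (fun t => winner (a t) (diag v)).
  by apply/funext => t; rewrite (bformC _ wsb) winner_diagl (bformC _ sb).
exact: winner_cvg.
Qed.

End WeightedProduct.

Lemma lipschitz_cvg0 {R : realType} {H : normedModType R} {T : Type}
    {F : set_system T} {FF : Filter F} (K : R) (S : H -> H) (u v : T -> H) :
  lipschitz_with K S ->
  u t - v t @[t --> F] --> (0 : H) -> S (u t) - S (v t) @[t --> F] --> (0 : H).
Proof.
move=> lS /norm_cvg0P uv; apply/norm_cvg0P.
apply: (@squeeze_cvgr _ _ _ _ (fun=> 0) (fun t => K * `|u t - v t|)).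
- by apply: nearW => t; rewrite normr_ge0 /=; exact: lS.
- exact: cvg_cst.
- by rewrite -[X in _ --> X](mulr0 K); apply: cvgMl_tmp.
Qed.

(** * The iteration, its step size and its fixed points *)

Section Algorithm.
Context {R : realType} {H : completeNormedModType R}.
Variable inner : H -> H -> R.
Hypothesis hi : is_inner_product inner.
Variables (m : nat) (A : 'I_m -> H -> set H) (B C : H -> H).
Variables (L beta gamma : R) (omega : 'I_m -> R).
Variables (x : nat -> H) (z yy : 'I_m -> nat -> H).
Hypothesis mA : forall i, maximally_monotone inner (A i).
Hypothesis mB : monotone_fun inner B.
Hypothesis L0 : 0 < L.
Hypothesis lB : lipschitz_with L B.
Hypothesis beta0 : 0 < beta.
Hypothesis cC : cocoercive inner beta C.
Hypothesis omega_gt0 : forall i, 0 < omega i.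
Hypothesis omega1 : \sum_(i < m) omega i = 1.
Hypothesis gamma0 : 0 < gamma.
Hypothesis gamma_lt : gamma < beta / (2 * (1 + 4 * beta * L)).
Hypothesis xE : forall n, x n.+1 = wmean m omega (z ^~ n).
Hypothesis yE : forall n i, exists u, A i (yy i n.+2) u /\
  2 *: x n.+1 - z i n - (2 * gamma) *: B (yy i n.+1)
  + gamma *: B (yy i n) - gamma *: C (yy i n.+1) =
  yy i n.+2 + (gamma / omega i) *: u.
Hypothesis zE : forall n i, z i n.+1 = z i n + yy i n.+2 - x n.+1.

Local Notation sb := (inner_symmetric_bilinear inner hi).
Local Notation ip := (winner inner m omega).
Local Notation wsb := (winner_symmetric_bilinear inner hi m omega).
Local Notation ip_ge0 := (winner_ge0 inner hi m omega omega_gt0).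
Local Notation mean := (wmean m omega).
Local Notation diag := (diag m).

Let Z n : 'I_m -> H := z ^~ n.
(** The index of [yy] is shifted by one, so [Y n] is the iterate y_n. *)
Let Y n : 'I_m -> H := yy ^~ n.+1.
Let d n := Y n.+1 - diag (x n.+1).
Let e n := Y n.+1 - Y n.
Let q := gamma / beta + 4 * (gamma * L).

Lemma step_size_bound : q < 2^-1.
Proof.
move: gamma_lt; rewrite ltr_pdivlMr; last by rewrite mulr_gt0 // !addr_gt0 ?mulr_gt0.
move=> h; rewrite /q -(ltr_pM2l beta0) mulrDr.
have -> : beta * (gamma / beta) = gamma by rewrite mulrC mulfVK // gt_eqF.
lra.
Qed.

Let gb0 : 0 < gamma / beta. Proof. by rewrite divr_gt0. Qed.
Let gL0 : 0 < gamma * L. Proof. by rewrite mulr_gt0. Qed.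

Lemma cocoercive_lipschitz : lipschitz_with beta^-1 C.
Proof.
move=> a b; have h := cC a b.
have h1 := le_trans (ler_norm _) (inner_cauchy_schwarz _ hi (a - b) (C a - C b)).
have [->|ne] := eqVneq (C a - C b) 0.
  by rewrite normr0 mulr_ge0 // invr_ge0 ltW.
have n0 : 0 < `|C a - C b| by rewrite normr_gt0.
rewrite -(ler_pM2l beta0) mulrA divff ?gt_eqF // mul1r -(ler_pM2r n0) -mulrA -expr2.
exact: le_trans h h1.
Qed.

Lemma Z_succ n : Z n.+1 = Z n + d n.
Proof. by apply/funext => i; rewrite /Z zE -addrA. Qed.

(** The mean of [d n] is [x n.+2 - x n.+1], so [e n.+1] is [d n.+1] minus the part of [d n]
    orthogonal to the diagonal. *)
Lemma e_le n : ip (e n.+1) (e n.+1) <= 2 * ip (d n.+1) (d n.+1) + 2 * ip (d n) (d n).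
Proof.
have -> : e n.+1 = d n.+1 + - (d n - diag (mean (d n))).
  have -> : mean (d n) = x n.+2 - x n.+1.
    by rewrite !xE -(wmeanB m) -/(Z n.+1) -/(Z n) Z_succ addrC addKr.
  apply/funext => i; apply: (inner_ext _ hi) => v.
  by rewrite /d /e /diag !fctE !(bformE _ sb); lra.
apply: le_trans (bform_sqD _ wsb ip_ge0 _ _) _; rewrite lerD2l ler_pM2l //.
rewrite (bformNl _ wsb) (bformNr _ wsb) opprK.
apply: (bform_sub_proj _ wsb ip_ge0).
exact: winner_proj.
Qed.

(** Stationarity of the iteration: when every y equals [mean zs], the two B terms of the resolvent
    inclusion merge into one. *)
Definition fixed_point (zs : 'I_m -> H) : Prop := exists u : 'I_m -> H,
  forall i, A i (mean zs) (u i) /\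
    mean zs - zs i - gamma *: B (mean zs) - gamma *: C (mean zs) =
    (gamma / omega i) *: u i.

Lemma fixed_point_of_zero x0 (u : 'I_m -> H) : (forall i, A i x0 (u i)) ->
  \sum_(i < m) u i + B x0 + C x0 = 0 -> exists zs, fixed_point zs.
Proof.
move=> Au u0.
(* The fixed point equation solved for [zs i]; in the mean the weights cancel and the zero equation
   leaves [x0]. *)
pose zs i := x0 - gamma *: (B x0 + C x0) - (gamma / omega i) *: u i.
have mz : mean zs = x0.
  rewrite /wmean /zs.
  under eq_bigr => i _ do rewrite scalerBr scalerA [_ * (_ / _)]mulrC mulfVK ?gt_eqF //.
  rewrite sumrB -scaler_suml omega1 scale1r -scaler_sumr -addrA -opprD -scalerDr.
  by rewrite addrC [X in gamma *: X]addrC addrA u0 scaler0 oppr0 add0r.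
exists zs, u => i; rewrite mz; split=> //.
by apply: (inner_ext _ hi) => v; rewrite /zs !(bformE _ sb); lra.
Qed.

Lemma zero_of_fixed_point zs (u : 'I_m -> H) :
  (forall i, mean zs - zs i - gamma *: B (mean zs) - gamma *: C (mean zs) =
    (gamma / omega i) *: u i) ->
  \sum_(i < m) u i + B (mean zs) + C (mean zs) = 0.
Proof.
move=> h; set p := mean zs in h *.
have : \sum_(i < m) omega i *: (p - zs i - gamma *: B p - gamma *: C p) =
    gamma *: \sum_(i < m) u i.
  rewrite scaler_sumr; apply: eq_bigr => i _.
  by rewrite h scalerA mulrC mulfVK // gt_eqF.
under eq_bigr => i _ do rewrite !scalerBr.
rewrite !sumrB -!scaler_suml omega1 !scale1r -/(mean zs) subrr sub0r => e0.
have : gamma *: (\sum_(i < m) u i + B p + C p) = 0.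
  by rewrite !scalerDr -e0 [- _ - _ + _]addrAC addNr add0r addNr.
by move/eqP; rewrite scaler_eq0 gt_eqF //= => /eqP.
Qed.

(** * Decrease of the Lyapunov function and its consequences *)

Section Lyapunov.
Variable zs : 'I_m -> H.
Hypothesis zsF : fixed_point zs.

Let xs := mean zs.
Let BY n : 'I_m -> H := fun i => B (yy i n.+1).
Let CY n : 'I_m -> H := fun i => C (yy i n.+1).
Let c n := Z n.+1 - zs.
Let b n := Y n.+1 - diag xs.

Definition lyapunov n : R :=
  ip (c n) (c n) - 2 * gamma * ip (b n) (BY n.+1 - BY n)
  + gamma * L * ip (e n) (e n) + q * ip (d n) (d n).

Lemma BY_le n : L^-1 * ip (BY n.+1 - BY n) (BY n.+1 - BY n) <= L * ip (e n) (e n).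
Proof.
rewrite -(ler_pM2l L0) mulrA divff ?gt_eqF // mul1r mulrA -expr2 /winner mulr_sumr.
apply: ler_sum => i _; rewrite !(innerxx _ hi) [leRHS]mulrCA ler_pM2l // -exprMn.
by rewrite lerXn2r ?nnegrE ?mulr_ge0 ?(ltW L0) //; exact: lB.
Qed.

(** [b n] is the part of [d n] orthogonal to the diagonal plus the projection of [c n], and neither
    operation increases the norm. *)
Lemma b_le n : ip (b n) (b n) <= 2 * ip (d n) (d n) + 2 * ip (c n) (c n).
Proof.
have -> : b n = (d n - diag (mean (d n))) + diag (mean (c n)).
  have -> : mean (c n) = mean (d n) + x n.+1 - xs.
    by rewrite /c Z_succ wmeanB wmeanD xE [mean (d n) + _]addrC.
  apply/funext => i; apply: (inner_ext _ hi) => v.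
  by rewrite /b /d /diag !fctE !(bformE _ sb); lra.
apply: le_trans (bform_sqD _ wsb ip_ge0 _ _) _; apply: lerD; rewrite ler_pM2l //.
  by apply: (bform_sub_proj _ wsb ip_ge0); exact: winner_proj.
exact: winner_proj_le.
Qed.

(** Young with weight [L] bounds the cross term; its [e n] part cancels, the [d n] part is covered
    by [q], and [2 gamma L <= 1/2] leaves half of the [c n] square. *)
Lemma lyapunov_ge n : 2^-1 * ip (c n) (c n) <= lyapunov n.
Proof.
have := bform_young _ wsb ip_ge0 L (b n) (BY n.+1 - BY n) L0.
rewrite ler_norml => /andP[_ /(ler_wpM2l (ltW gamma0))].
have := ler_wpM2l (ltW gamma0) (BY_le n).
have := ler_wpM2l (ltW gL0) (b_le n).
have [gb gl] := (gb0, gL0).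
rewrite /lyapunov; have := step_size_bound; rewrite /q => h.
have h1 : 0 <= (gamma / beta + 2 * (gamma * L)) * ip (d n) (d n).
  by rewrite mulr_ge0 ?ip_ge0 //; lra.
have h2 : 0 <= (2^-1 - 2 * (gamma * L)) * ip (c n) (c n).
  by rewrite mulr_ge0 ?ip_ge0 //; lra.
lra.
Qed.

(** After [descent_step], Young splits the remaining B term into [gamma L] times the squares of
    [e n.+1] and [e n]. The latter is stored in [lyapunov n]; the total coefficient of the former is
    [q / 2], and [e_le] trades it for [q] times the squares of [d n.+1] and [d n]. *)
Lemma lyapunov_le n :
  lyapunov n.+1 <= lyapunov n - (1 - 2 * q) * ip (d n.+1) (d n.+1).
Proof.
have [u hu] := zsF.
have eb : b n.+1 - b n = e n.+1 by rewrite /b subrBB.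
have ed : b n.+1 - diag (x n.+2 - xs) = d n.+1 by rewrite /b diagB subrBB.
have ec : c n + b n.+1 - diag (x n.+2 - xs) = c n.+1.
  by rewrite -addrA ed /c [Z n.+2]Z_succ addrAC.
pose Bs : 'I_m -> H := diag (B xs).
have := @descent_step _ _ ip wsb ip_ge0 beta gamma (diag (x n.+2 - xs)) (b n.+1)
  (c n) (b n) (BY n.+2 - Bs) (BY n.+1 - Bs) (BY n - Bs) (CY n.+1 - diag (C xs))
  beta0 gamma0.
rewrite eb ed ec !subrBB.
have -> : x n.+2 - xs = mean (c n) by rewrite /c wmeanB xE.
have h1 : ip (diag (mean (c n))) (c n - diag (mean (c n))) = 0.
  by rewrite (bformDr _ wsb) (bformNr _ wsb) winner_proj // subrr.
(* Componentwise monotonicity of [A i] between the new y and the solution, scaled by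
   [gamma / omega i]. *)
have h2 : 0 <= ip (b n.+1) (2 *: diag (mean (c n)) - c n - b n.+1 -
    (2 * gamma) *: (BY n.+1 - Bs) + gamma *: (BY n - Bs) -
    gamma *: (CY n.+1 - diag (C xs))).
  apply: sumr_ge0 => i _; rewrite mulr_ge0 ?(ltW (omega_gt0 i)) //.
  have [w [Aw ew]] := yE n.+1 i; have [Au eu] := hu i.
  have mono := (mA i).1 _ _ _ _ Aw Au.
  have lam0 : 0 <= gamma / omega i by rewrite ltW // divr_gt0.
  have := mulr_ge0 lam0 mono.
  have -> : mean (c n) = x n.+2 - xs by rewrite /c wmeanB xE.
  rewrite /b /c /Y /Z /BY /CY /Bs /diag !fctE -/xs.
  move: (congr1 (inner (yy i n.+3 - xs)) ew) (congr1 (inner (yy i n.+3 - xs)) eu).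
  rewrite -/xs; move et: (yy i n.+3 - xs) => t.
  have -> : yy i n.+3 = t + xs by rewrite -et subrK.
  by rewrite !(bformE _ sb); lra.
have h3 : 0 <= ip (b n.+1) (BY n.+2 - Bs).
  by apply: sumr_ge0 => i _; rewrite mulr_ge0 ?(ltW (omega_gt0 i)) //; exact: mB.
have h4 : beta * ip (CY n.+1 - diag (C xs)) (CY n.+1 - diag (C xs)) <=
    ip (b n) (CY n.+1 - diag (C xs)).
  rewrite /winner mulr_sumr; apply: ler_sum => i _.
  by rewrite (innerxx _ hi) mulrCA ler_pM2l //; exact: cC.
move=> /(_ h1 h2 h3 h4) key.
have := bform_young _ wsb ip_ge0 L (e n.+1) (BY n.+1 - BY n) L0.
rewrite ler_norml => /andP[/(ler_wpM2l (ltW gamma0)) hy _].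
have hB := ler_wpM2l (ltW gamma0) (BY_le n).
have q0 : 0 <= q by have [g1 g2] := (gb0, gL0); rewrite /q; lra.
have he := ler_wpM2l q0 (e_le n).
have hq : gamma / (2 * beta) = q / 2 - 2 * (gamma * L).
  by rewrite /q invfM; lra.
rewrite /lyapunov; move: key hy hB he; rewrite hq.
move: (ip _ (BY n.+2 - _)) (L^-1 * _) (ip (e n) _) (ip (d n) (d n)) (ip (c n) _).
move=> X1 X2 X3 X4 X5.
lra.
Qed.

Lemma lyapunov_cvg : cvgn lyapunov.
Proof.
apply: nonincreasing_is_cvgn.
  apply/nonincreasing_seqP => n; apply: le_trans (lyapunov_le n) _.
  rewrite lerBlDr lerDl mulr_ge0 ?ip_ge0 //; have := step_size_bound; lra.
exists 0 => _ [n _ <-]; apply: le_trans (lyapunov_ge n).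
by rewrite mulr_ge0 ?ip_ge0.
Qed.

Lemma ip_d_cvg0 : ip (d n) (d n) @[n --> \oo] --> (0 : R).
Proof.
rewrite -cvg_shiftS /=.
have q1 : 0 < 1 - 2 * q by have := step_size_bound; lra.
(* The upper bound is a multiple of successive differences of a convergent sequence. *)
apply: (@squeeze_cvgr _ _ _ _ (fun=> 0)
  (fun n => (1 - 2 * q)^-1 * (lyapunov n - lyapunov n.+1))).
- apply: nearW => n; rewrite ip_ge0 /= -(ler_pM2l q1) mulrA divff ?gt_eqF //.
  by rewrite mul1r; have := lyapunov_le n; lra.
- exact: cvg_cst.
- rewrite -[X in _ --> X](mulr0 (1 - 2 * q)^-1); apply: cvgMl_tmp.
  rewrite -(subrr (limn lyapunov)); apply: cvgB; first exact: lyapunov_cvg.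
  by rewrite (cvg_shiftS lyapunov); exact: lyapunov_cvg.
Qed.

Lemma ip_e_cvg0 : ip (e n) (e n) @[n --> \oo] --> (0 : R).
Proof.
rewrite -cvg_shiftS /=.
apply: (@squeeze_cvgr _ _ _ _ (fun=> 0)
  (fun n => 2 * ip (d n.+1) (d n.+1) + 2 * ip (d n) (d n))).
- by apply: nearW => n; rewrite ip_ge0 /= e_le.
- exact: cvg_cst.
- rewrite -[X in _ --> X]addr0; apply: cvgD; rewrite -[X in _ --> X](mulr0 2);
    apply: cvgMl_tmp; last exact: ip_d_cvg0.
  by rewrite (cvg_shiftS (fun n => ip (d n) (d n))); exact: ip_d_cvg0.
Qed.

Lemma d_cvg0 i : d n i @[n --> \oo] --> (0 : H).
Proof. exact: (winner_cvg0 inner hi m omega omega_gt0 d ip_d_cvg0). Qed.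

Lemma e_cvg0 i : e n i @[n --> \oo] --> (0 : H).
Proof. exact: (winner_cvg0 inner hi m omega omega_gt0 e ip_e_cvg0). Qed.

Lemma z_bounded i : exists M, forall n, `|z i n| <= M.
Proof.
have noninc n : lyapunov n <= lyapunov 0.
  elim: n => // n; apply: le_trans; apply: le_trans (lyapunov_le n) _.
  rewrite lerBlDr lerDl mulr_ge0 ?ip_ge0 //; have := step_size_bound; lra.
pose K := 2 * lyapunov 0 / omega i.
(* [lyapunov n] controls index [n.+1], so [z i 0] is added by hand. *)
exists (K + 1 + `|zs i| + `|z i 0|) => -[|n].
  rewrite lerDr; have := ip_ge0 (c 0); have := lyapunov_ge 0 => h1 h2.
  have : 0 <= K by rewrite divr_ge0 ?(ltW (omega_gt0 i)) //; lra.
  by have := normr_ge0 (zs i); lra.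
have h : `|c n i| ^+ 2 <= K.
  rewrite ler_pdivlMr // mulrC; apply: le_trans (le_winner _ hi _ _ omega_gt0 _ i) _.
  by have := lyapunov_ge n; have := noninc n; lra.
have h1 : `|c n i| <= K + 1 by have := sqr_ge0 (`|c n i| - 2^-1); nra.
have := ler_normD (c n i) (zs i); rewrite /c !fctE subrK -/(c n i).
by have := normr_ge0 (z i 0); move: h1; rewrite /c !fctE /Z; lra.
Qed.

Lemma x_bounded : exists M, forall n, `|x n.+1| <= M.
Proof.
have /choice[M hM] := z_bounded.
exists (\sum_(i < m) omega i * M i) => n; rewrite xE.
apply: le_trans (ler_norm_sum _ _ _) _; apply: ler_sum => i _.
by rewrite normrZ gtr0_norm // ler_pM2l.
Qed.

Lemma y_bounded i : exists M, forall n, `|yy i n.+2| <= M.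
Proof.
have [Mx hx] := x_bounded; have [Mz hz] := z_bounded i.
exists (Mx + Mz + Mz) => n.
have -> : yy i n.+2 = x n.+1 + z i n.+1 - z i n.
  by apply: (inner_ext _ hi) => v; rewrite zE !(bformE _ sb); lra.
apply: le_trans (ler_normB _ _) _; apply: lerD => //.
by apply: le_trans (ler_normD _ _) _; apply: lerD.
Qed.

(** The squared distance differs from [lyapunov] by vanishing terms; the cross term pairs a bounded
    sequence with a null one. *)
Lemma ip_dist_cvg : cvgn (fun n => ip (Z n - zs) (Z n - zs)).
Proof.
suff /cvg_ex[l hl] : cvgn (fun n => ip (Z n.+1 - zs) (Z n.+1 - zs)).
  by apply/cvg_ex; exists l; rewrite -cvg_shiftS.
have -> : (fun n => ip (Z n.+1 - zs) (Z n.+1 - zs)) = (fun n => lyapunov n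
    + 2 * gamma * ip (b n) (BY n.+1 - BY n) - gamma * L * ip (e n) (e n)
    - q * ip (d n) (d n)).
  by apply/funext => n; rewrite /lyapunov -/(c n); lra.
apply: is_cvgB; last by apply: is_cvgMl_tmp; apply/cvg_ex; exists 0; exact: ip_d_cvg0.
apply: is_cvgB; last by apply: is_cvgMl_tmp; apply/cvg_ex; exists 0; exact: ip_e_cvg0.
apply: is_cvgD; first exact: lyapunov_cvg.
apply: is_cvgMl_tmp; apply/cvg_ex; exists (\sum_(i < m) omega i * 0).
apply: wsum_cvg => i.
have [M hM] := y_bounded i.
apply: (inner_cvg0 _ hi (fun n => b n i) (fun n => (BY n.+1 - BY n) i) (M + `|xs|)).
  by move=> n; apply: (le_trans (ler_normB (yy i n.+2) xs)); rewrite lerD2r; exact: hM.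
apply: (lipschitz_cvg0 L B (fun n => yy i n.+2) (fun n => yy i n.+1) lB).
exact: e_cvg0.
Qed.

End Lyapunov.

(** * Identification and uniqueness of the weak limits *)

Lemma forward_lipschitz :
  lipschitz_with (gamma * (L + beta^-1)) (fun p => gamma *: (B p + C p)).
Proof.
move=> p p'; rewrite -scalerBr normrZ gtr0_norm // -mulrA ler_pM2l // mulrDl.
have -> : B p + C p - (B p' + C p') = (B p - B p') + (C p - C p').
  by rewrite opprD addrACA.
apply: le_trans (ler_normD _ _) _; apply: lerD; first exact: lB.
exact: cocoercive_lipschitz.
Qed.

Lemma ultra_fixed_point (zs zb : 'I_m -> H) (G : set_system nat) :
  fixed_point zs -> UltraFilter G -> \oo `<=` G ->
  (forall i, weak_cvg inner nat G (z i) (zb i)) -> fixed_point zb.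
Proof.
move=> zsF GU subG wz; pose xb := mean zb.
have wx : weak_cvg inner nat G (fun n => x n.+1) xb.
  have -> : (fun n => x n.+1) = mean \o Z by apply/funext => n; rewrite xE.
  exact: (weak_cvg_wmean inner hi m omega Z zb wz).
have k01 : 0 <= gamma * (L + beta^-1) < 1.
  have := step_size_bound; have [g1 g2] := (gb0, gL0); rewrite /q mulrDr => h.
  by apply/andP; split; lra.
(* Each test point solves, at the limit, the inclusion expected of [xb]; the argument ends by
   showing that it equals [xb]. *)
have /choice[pu hpu] : forall i, exists pu : H * H, A i pu.1 pu.2 /\
    2 *: xb - zb i = pu.1 + (gamma / omega i) *: pu.2
      + gamma *: (B pu.1 + C pu.1).
  move=> i; have lam0 : 0 < gamma / omega i by rewrite divr_gt0.
  have [p [u [Ap ep]]] := resolvent_contraction inner hi (A i) _ _ _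
    (2 *: xb - zb i) (mA i) lam0 k01 forward_lipschitz.
  by exists (p, u).
pose p i := (pu i).1; pose s i := 2 *: xb - zb i - p i.
(* The error made when B and C are evaluated at the new y: [x n.+1 - z i n + eps n i] belongs
   exactly to [gamma / omega i A_i + gamma (B + C)] there. *)
pose eps n i := - d n i + gamma *: (B (yy i n.+2) - B (yy i n.+1))
  - gamma *: (B (yy i n.+1) - B (yy i n))
  + gamma *: (C (yy i n.+2) - C (yy i n.+1)).
have e0 i : yy i n.+2 - yy i n.+1 @[n --> \oo] --> (0 : H) := e_cvg0 _ zsF i.
have em0 i : yy i n.+1 - yy i n @[n --> \oo] --> (0 : H).
  by rewrite -cvg_shiftS; exact: e0.
have eps0 i : eps n i @[n --> \oo] --> (0 : H).
  have scal0 (f : nat -> H) : f @ \oo --> (0 : H) ->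
      gamma *: f n @[n --> \oo] --> (0 : H).
    by move=> f0; rewrite -[X in _ --> X](scaler0 _ gamma); exact: cvgZl_tmp.
  have lip0 K (S : H -> H) (f g : nat -> H) : lipschitz_with K S ->
      f n - g n @[n --> \oo] --> (0 : H) ->
      gamma *: (S (f n) - S (g n)) @[n --> \oo] --> (0 : H).
    by move=> lS fg; apply: scal0; exact: (lipschitz_cvg0 K S f g lS fg).
  have d0 := d_cvg0 _ zsF i.
  have -> : (0 : H) = - 0 + 0 - 0 + 0 by rewrite !oppr0 !addr0.
  apply: cvgD; last exact: lip0 cocoercive_lipschitz (e0 i).
  apply: cvgB; last exact: lip0 lB (em0 i).
  by apply: cvgD; [exact: cvgN d0|exact: lip0 lB (e0 i)].
pose r n i := x n.+1 - z i n + eps n i.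
have mono n i : 0 <= inner (x n.+1 + d n i - p i) (r n i - s i).
  have [w [Aw ew]] := yE n i; have [Au eu] := hpu i.
  have lam0 : 0 <= gamma / omega i by rewrite ltW // divr_gt0.
  have hA := mulr_ge0 lam0 ((mA i).1 _ _ _ _ Aw Au).
  have hB := mulr_ge0 (ltW gamma0) (mB (yy i n.+2) (p i)).
  have hC : 0 <= gamma * inner (yy i n.+2 - p i) (C (yy i n.+2) - C (p i)).
    apply: mulr_ge0; first exact: ltW.
    by apply: le_trans (cC _ _); rewrite mulr_ge0 ?exprn_ge0 // ltW.
  have -> : x n.+1 + d n i = yy i n.+2 by rewrite addrC; exact: subrK.
  move: hA hB hC (congr1 (inner (yy i n.+2 - p i)) ew)
    (congr1 (inner (yy i n.+2 - p i)) eu).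
  rewrite -/(p i) /r /s /eps /d !fctE /Y; move: (yy i n.+2 - p i) => t.
  by rewrite !(bformE _ sb) /diag; lra.
have zero (a : 'I_m -> H) : ip (diag (mean a)) (diag (mean a) - a) = 0.
  by rewrite (bformDr _ wsb) (bformNr _ wsb) winner_proj // subrr.
(* The product in [mono] without [inner (x n.+1) (x n.+1 - z i n)], the only term out of reach of
   weak limits; its weighted sum vanishes by [zero]. *)
pose T n i := inner (x n.+1) (eps n i) + inner (r n i - s i) (d n i)
  - inner (p i) (eps n i) - inner (x n.+1) (s i) - inner (x n.+1) (p i)
  + inner (z i n) (p i) + inner (p i) (s i).
have T_ge0 n : 0 <= \sum_(i < m) omega i * T n i.
  have -> : \sum_(i < m) omega i * T n i =
      \sum_(i < m) omega i * inner (x n.+1 + d n i - p i) (r n i - s i)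
      - ip (diag (mean (Z n))) (diag (mean (Z n)) - Z n).
    rewrite -sumrB; apply: eq_bigr => i _.
    rewrite -mulrBr /diag !fctE -xE /Z /T /r; congr (_ * _).
    move: (eps n i) (s i) (p i) (d n i) (x n.+1) (z i n) => E S P D X W.
    rewrite !(bformE _ sb) (bformC _ sb P X) (bformC _ sb P W) (bformC _ sb X D).
    by rewrite (bformC _ sb W D) (bformC _ sb E D) (bformC _ sb S D); lra.
  rewrite zero subr0; apply: sumr_ge0 => i _.
  by rewrite mulr_ge0 // ltW.
have subcvg (f : nat -> R) (l : R) : f @ \oo --> l -> f @ G --> l.
  by move=> fl N Nl; apply: subG; exact: fl.
have [Mx hx] := x_bounded _ zsF.
have T_cvg i : T n i @[n --> G] --> 0 + 0 - 0 - inner xb (s i) - inner xb (p i)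
    + inner (zb i) (p i) + inner (p i) (s i).
  have [Mz hz] := z_bounded _ zsF i.
  have cx : inner (x n.+1) (eps n i) @[n --> \oo] --> (0 : R).
    exact: (inner_cvg0 _ hi (fun n => x n.+1) (fun n => eps n i) Mx hx (eps0 i)).
  have cp : inner (p i) (eps n i) @[n --> \oo] --> (0 : R).
    exact: (inner_cvg0 _ hi (fun=> p i) (fun n => eps n i) `|p i| _ (eps0 i)).
  have cd : inner (r n i - s i) (d n i) @[n --> \oo] --> (0 : R).
    have -> : (fun n => inner (r n i - s i) (d n i)) =
        (fun n => inner (x n.+1 - z i n - s i) (d n i) + inner (eps n i) (d n i)).
      by apply/funext => n; rewrite /r !(bformE _ sb); lra.
    rewrite -[X in _ --> X]addr0; apply: cvgD.
      apply: (inner_cvg0 _ hi (fun n => x n.+1 - z i n - s i) (fun n => d n i)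
        (Mx + Mz + `|s i|)); last exact: d_cvg0 zsF i.
      move=> n; apply: le_trans (ler_normB _ _) _; rewrite lerD2r.
      by apply: le_trans (ler_normB _ _) _; apply: lerD.
    have [My hy] := y_bounded _ zsF i.
    have -> : (fun n => inner (eps n i) (d n i)) = (fun n => inner (d n i) (eps n i)).
      by apply/funext => n; rewrite (bformC _ sb).
    apply: (inner_cvg0 _ hi (fun n => d n i) (fun n => eps n i) (My + Mx)) => // n.
    by apply: (le_trans (ler_normB (yy i n.+2) (x n.+1))); apply: lerD.
  apply: cvgD; last exact: cvg_cst.
  apply: cvgD; last exact: wz.
  apply: cvgB; last exact: wx.
  apply: cvgB; last exact: wx.
  apply: cvgB; last exact: subcvg cp.
  by apply: cvgD; [exact: subcvg cx|exact: subcvg cd].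
have : 0 <= \sum_(i < m) omega i * (0 + 0 - 0 - inner xb (s i) - inner xb (p i)
    + inner (zb i) (p i) + inner (p i) (s i)).
  by apply: (cvgr_to_ge (wsum_cvg m omega _ _ T_cvg)); exact: nearW.
(* The limit is minus the squared distance from [p] to the diagonal point [xb], up to another term
   killed by [zero]. *)
have -> : \sum_(i < m) omega i * (0 + 0 - 0 - inner xb (s i) - inner xb (p i)
    + inner (zb i) (p i) + inner (p i) (s i)) =
    - ip (diag xb - p) (diag xb - p) - ip (diag xb) (diag xb - zb).
  rewrite -opprD -big_split -sumrN; apply: eq_bigr => i _ /=.
  rewrite -mulrDr -mulrN /diag !fctE /s; congr (_ * _).
  by rewrite !(bformE _ sb) (bformC _ sb (p i) xb) (bformC _ sb (p i) (zb i)); lra.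
rewrite zero subr0 oppr_ge0 => h; have hp := winner_eq0 _ hi _ _ omega_gt0 _ h.
have pE i : (pu i).1 = xb by have /eqP := hp i; rewrite /diag !fctE subr_eq0 => /eqP.
exists (fun i => (pu i).2) => i; have [Au eu] := hpu i; split; rewrite -/xb.
  by rewrite pE in Au.
rewrite !pE in eu; apply: (inner_ext _ hi) => v.
by move/(congr1 (inner ^~ v)): eu; rewrite !(bformE _ sb); lra.
Qed.

(** Opial: the product of [Z n] with [zb - zb'] is an affine combination of squared distances to two
    fixed points, so it converges along [\oo]. Both limits thus have the same product with
    [zb - zb']. *)
Lemma ultra_limit_unique (zb zb' : 'I_m -> H) (G G' : set_system nat) :
  fixed_point zb -> fixed_point zb' ->
  UltraFilter G -> UltraFilter G' -> \oo `<=` G -> \oo `<=` G' ->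
  (forall i, weak_cvg inner nat G (z i) (zb i)) ->
  (forall i, weak_cvg inner nat G' (z i) (zb' i)) -> zb = zb'.
Proof.
move=> F F' GU GU' sG sG' w w'.
have /cvg_ex[l hl] : cvgn (fun n => ip (Z n) (zb - zb')).
  have -> : (fun n => ip (Z n) (zb - zb')) = (fun n => 2^-1 *
      (ip (Z n - zb') (Z n - zb') - ip (Z n - zb) (Z n - zb)
       - (ip zb' zb' - ip zb zb))).
    apply/funext => n; rewrite !(bformE _ wsb).
    by rewrite (bformC _ wsb zb' (Z n)) (bformC _ wsb zb (Z n)); lra.
  apply: is_cvgMl_tmp; apply: is_cvgB; last exact: is_cvg_cst.
  by apply: is_cvgB; exact: ip_dist_cvg.
have lim_eq (K : set_system nat) (v : 'I_m -> H) : UltraFilter K -> \oo `<=` K ->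
    (forall i, weak_cvg inner nat K (z i) (v i)) -> ip v (zb - zb') = l.
  move=> KU sK wv.
  have cK : ip (Z n) (zb - zb') @[n --> K] --> ip v (zb - zb').
    exact: (winner_cvg inner m omega Z v (zb - zb') wv).
  apply: (cvg_unique _ cK); first exact: norm_hausdorff.
  by move=> N Nl; apply: sK; exact: hl.
have h0 : ip (zb - zb') (zb - zb') <= 0.
  by rewrite [leLHS](bformDl _ wsb) (bformNl _ wsb) (lim_eq G) // (lim_eq G') // subrr.
apply/funext => i; apply/eqP; rewrite -subr_eq0; apply/eqP.
exact: (winner_eq0 _ hi _ _ omega_gt0 _ h0 i).
Qed.

Lemma weak_cvg_fixed_point zs : fixed_point zs ->
  exists zb, fixed_point zb /\ weakly_converges_to inner x (mean zb).
Proof.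
move=> zsF.
have ulim (G : set_system nat) : UltraFilter G -> exists zb : 'I_m -> H,
    forall i, weak_cvg inner nat G (z i) (zb i).
  move=> GU.
  have /choice[zb hz] : forall i, exists p, weak_cvg inner nat G (z i) p.
    move=> i; have [M hM] := z_bounded _ zsF i.
    exact: (ultra_bounded_weak_cvg _ hi _ _ GU _ M hM).
  by exists zb.
have [G0 [GU0 sub0]] := ultraFilterLemma eventually_filter.
have [zb wzb] := ulim _ GU0.
have zbF := ultra_fixed_point _ _ _ zsF GU0 sub0 wzb.
(* The shift is needed because [xE] ties [x] to the means only from index 1 on. *)
exists zb; split=> // v; rewrite -cvg_shiftS.
apply: cvg_of_ultrafilters => G GU subG.
have [zb' wzb'] := ulim _ GU.
have zbF' := ultra_fixed_point _ _ _ zsF GU subG wzb'.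
rewrite (ultra_limit_unique _ _ _ _ zbF zbF' GU0 GU sub0 subG wzb wzb').
have -> : (fun n => inner (x n.+1) v) = (fun n => inner ((mean \o Z) n) v).
  by apply/funext => n; rewrite xE.
exact: (weak_cvg_wmean inner hi m omega Z zb' wzb').
Qed.

End Algorithm.

(* yy i k stands for y_{i,k-1}: yy i 0 = y_{i,-1}, yy i 1 = y_{i,0}. *)
Theorem theorem4p1 (R : realType) (H : completeNormedModType R)
  (inner : H -> H -> R) (m : nat) (A : 'I_m -> H -> set H) (B C : H -> H)
  (L beta gamma : R) (omega : 'I_m -> R)
  (x : nat -> H) (z yy : 'I_m -> nat -> H) :
  is_inner_product inner ->
  (0 < m)%N ->
  (forall i, maximally_monotone inner (A i)) ->
  monotone_fun inner B -> 0 < L -> lipschitz_with L B ->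
  0 < beta -> cocoercive inner beta C ->
  (exists x0 : H, exists u : 'I_m -> H,
      (forall i, A i x0 (u i)) /\ \sum_(i < m) u i + B x0 + C x0 = 0) ->
  (forall i, 0 < omega i <= 1) -> \sum_(i < m) omega i = 1 ->
  0 < gamma < beta / (2 * (1 + 4 * beta * L)) ->
  (forall n, x n.+1 = \sum_(j < m) omega j *: z j n) ->
  (forall n i, yy i n.+2 =
      resolvent (gamma / omega i) (A i)
        (2 *: x n.+1 - z i n - (2 * gamma) *: B (yy i n.+1)
         + gamma *: B (yy i n) - gamma *: C (yy i n.+1))) ->
  (forall n i, z i n.+1 = z i n + yy i n.+2 - x n.+1) ->
  exists xs : H,
    weakly_converges_to inner x xs /\
    exists u : 'I_m -> H,
      (forall i, A i xs (u i)) /\ \sum_(i < m) u i + B xs + C xs = 0.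
Proof.
move=> hi _ mA mB L0 lB beta0 cC [x0 [u [Au u0]]] om om1 /andP[g0 g1] xE yE zE.
have om0 i : 0 < omega i by case/andP: (om i).
have yE' n i : exists u, A i (yy i n.+2) u /\
    2 *: x n.+1 - z i n - (2 * gamma) *: B (yy i n.+1)
    + gamma *: B (yy i n) - gamma *: C (yy i n.+1) =
    yy i n.+2 + (gamma / omega i) *: u.
  by rewrite yE; apply: (resolventP _ hi) => //; rewrite divr_gt0.
have [zs zsF] := fixed_point_of_zero _ hi _ _ _ _ gamma _ om0 om1 _ _ Au u0.
have [zb [[v hv] wx]] := weak_cvg_fixed_point _ hi _ _ _ _ _ _ _ _ _ _ _
  mA mB L0 lB beta0 cC om0 om1 g0 g1 xE yE' zE _ zsF.
exists (wmean m omega zb); split=> //; exists v; split=> [i|].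
  exact: (hv i).1.
exact: (zero_of_fixed_point _ _ _ _ _ om0 om1 g0 _ _ (fun i => (hv i).2)).
Qed.
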